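(* Let $h$ be an odd positive integer, $m=3h$, $\ell=3^{2h}-3^h+1$, $\alpha$ a generator of $\mathrm{GF}(3^m)^*$, and $D=\{\alpha^t : 0\le t\le (3^m-1)/2-1,\ \mathrm{Tr}(\alpha^t+\alpha^{t\ell})=0\}$. Then the ternary code $\mathcal{C}_D$ has parameters $\left[\frac{3^{3h-1}-1}{2},\ 3h,\ 3^{3h-2}-3^{2h-2}\right]$ and its nonzero weights and multiplicities are: $3^{3h-2}-3^{2h-2}$ with multiplicity $3^{2h}+3^h$; $3^{3h-2}$ with multiplicity $3^{3h}-2\cdot3^{2h}-1$; $3^{3h-2}+3^{2h-2}$ with multiplicity $3^{2h}-3^h$.
   Context: $\mathrm{Tr}$ denotes the absolute trace from $\mathrm{GF}(3^m)$ onto $\mathrm{GF}(3)$. For a subset $D=\{d_1,\dots,d_n\}\subseteq\mathrm{GF}(3^m)$ (listed in a fixed order), $\mathcal{C}_D=\{(\mathrm{Tr}(xd_1),\dots,\mathrm{Tr}(xd_n)) : x\in\mathrm{GF}(3^m)\}$, a linear code of length $n$ over $\mathrm{GF}(3)$. *)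

(* Defs.v *)
From HB Require Import structures.
From mathcomp Require Import all_boot all_order all_algebra all_field.
Set Implicit Arguments. Unset Strict Implicit. Unset Printing Implicit Defensive.
Import GRing.Theory.
Local Open Scope ring_scope.

Definition absTr (F : finFieldType) (m : nat) (x : F) : F :=
  \sum_(i < m) x ^+ (3 ^ i).

Definition defSet (F : finFieldType) (h : nat) (alpha : F) : seq F :=
  let m := (3 * h)%N in
  let l := (3 ^ (2 * h) - 3 ^ h + 1)%N in
  [seq alpha ^+ t | t <- iota 0 ((3 ^ m - 1) %/ 2)
                  & absTr m (alpha ^+ t + alpha ^+ (t * l)) == 0].

Definition codeword (F : finFieldType) (m : nat) (D : seq F) (x : F)
  : {ffun 'I_(size D) -> F} :=
  [ffun i : 'I_(size D) => absTr m (x * nth 0 D i)].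

Definition codeD (F : finFieldType) (m : nat) (D : seq F)
  : {set {ffun 'I_(size D) -> F}} :=
  [set codeword m D x | x : F].

Definition wt (F : finFieldType) (n : nat) (c : {ffun 'I_n -> F}) : nat :=
  #|[set i | c i != 0]|.

(* Main.v *)
(* Write q = 3^h, psi = omega^Tr and S(b) = sum_x psi(x^l + b x). By character orthogonality the
   codeword of a <> 0 has weight (q^3 - S(1 + a) - S(1 - a)) / 9, and S(1) = 0.
   Since (q + 1) l = q^3 + 1, the substitution x = eta(y) y^(q+1), eta the quadratic character,
   gives S(b) = Re Q(b), where Q(b) is the exponential sum of the quadratic form
   Tr(y^2 + b y^(q+1)). Then |Q(b)|^2 = q^3 r with r the size of the radical, r in {1, q, q^2};
   pairing y with -y gives S(b)^2 + 3 k^2 = q^3 r for an integer k, and descent at the prime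
   sqrt(-3) yields S(b) = 0 for r <> q and S(b) = +-q^2 for r = q.
   If S(b) <> 0, the circulant-type determinant of the radical equation vanishes; for b = 1 + a
   and b = 1 - a simultaneously this would make -1 a square, impossible as q^3 = 3 mod 4. Hence
   S(1 + a) + S(1 - a) lies in {0, q^2, -q^2}, and the first two moments of S give the
   multiplicities. *)
Require Import Defs.
From HB Require Import structures.
From mathcomp Require Import all_boot all_order all_algebra all_field.
From mathcomp Require Import ring zify.
Import GRing.Theory Num.Theory.
Local Open Scope ring_scope.

(** * Cube roots of unity and norms of Eisenstein integers *)

Definition omega : algC := sval (C_prim_root_exists (isT : (0 < 3)%N)).

Lemma omega_prim : 3.-primitive_root omega.
Proof. exact: (proj2_sig (C_prim_root_exists _)). Qed.

Lemma omega3 : omega ^+ 3 = 1.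
Proof. exact: prim_expr_order omega_prim. Qed.

Lemma omega_sum : 1 + omega + omega ^+ 2 = 0.
Proof.
have w1 : omega - 1 != 0.
  by rewrite subr_eq0 -[omega]expr1 -(prim_order_dvd omega_prim).
apply: (mulfI w1); rewrite mulr0.
transitivity (omega ^+ 3 - 1); first by ring.
by rewrite omega3 subrr.
Qed.

Lemma omega_conj : omega^* = omega ^+ 2.
Proof.
have w0 : omega != 0 by rewrite (prim_root_eq0 omega_prim).
have nw : `|omega| = 1.
  apply/eqP; rewrite -(@pexpr_eq1 _ _ 3) //.
  by rewrite -normrX omega3 normr1.
apply: (mulfI w0); rewrite -normCK nw expr1n -exprS; exact/esym/omega3.
Qed.

Lemma omega_sub_sqr : (omega - omega ^+ 2) ^+ 2 = -3%:R.
Proof.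
have e1 : omega ^+ 2 = - 1 - omega by apply/eqP; rewrite -subr_eq0 -omega_sum; apply/eqP; ring.
rewrite e1; transitivity (4%:R * omega ^+ 2 + 4%:R * omega + 1); first by ring.
by rewrite e1; ring.
Qed.

(* Unique factorisation at the ramified prime [sqrt -3] of the Eisenstein integers. *)
Lemma norm_form_pow3 (n : nat) (s k : int) :
  s ^+ 2 + 3 * k ^+ 2 = 3 ^+ n -> if odd n then s = 0 else k = 0.
Proof.
elim: n s k => [|n IHn] s k /=; first by rewrite expr0; nia.
rewrite [3 ^+ n.+1]exprS => e.
have [r er] : exists r, s = 3 * r.
  have /dvdzP [r ->] : (3 %| s)%Z.
    have: (3 %| s ^+ 2)%Z.
      apply/dvdzP; exists (3 ^+ n - k ^+ 2).
      by apply: (addIr (3 * k ^+ 2)); rewrite e; ring.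
    by rewrite !dvdzE abszX Euclid_dvdX // andbT.
  by exists r; rewrite mulrC.
(* Dividing [s + k * sqrt (-3)] by [sqrt (-3)] exchanges the two coordinates, hence the alternation
   with the parity of [n]. *)
have /IHn : k ^+ 2 + 3 * r ^+ 2 = 3 ^+ n by rewrite er in e; apply: (@mulfI _ (3 : int)) => //; rewrite -e; ring.
by case: (odd n) => //= r0; rewrite er r0 mulr0.
Qed.

(** With [y] the conjugate of [x], this splits the norm of [1 + 2 x] into its real part [1 + x + y]
    and its imaginary part [x - y]. *)
Lemma mul_double_succ (R : comPzRingType) (x y : R) :
  (1 + x *+ 2) * (1 + y *+ 2) = (1 + (x + y)) ^+ 2 - (x - y) ^+ 2.
Proof. by ring. Qed.

Section Field.

Variables (h : nat) (F : finFieldType).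
Hypothesis hodd : odd h.
Hypothesis hcard : #|F| = (3 ^ (3 * h))%N.

Notation m := (3 * h)%N.
Notation q := (3 ^ h)%N.
Notation Tr := (@absTr F m).

(** * The trace and the additive character *)

Lemma h_gt0 : (0 < h)%N.
Proof. by case: h hodd. Qed.

Lemma q_gt1 : (2 < q)%N.
Proof. by have := h_gt0; case: h => // k _; rewrite expnS; have := expn_gt0 3 k; lia. Qed.

Lemma pchar3 : 3 \in [pchar F].
Proof. exact: card_finPcharP hcard isT. Qed.

Lemma three0 : 3%:R = 0 :> F.
Proof. exact: pcharf0 pchar3. Qed.

Lemma frobD k (x y : F) : (x + y) ^+ (3 ^ k) = x ^+ (3 ^ k) + y ^+ (3 ^ k).
Proof. by apply: exprDn_pchar; rewrite pnatX pnatE // pchar3. Qed.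

Lemma frobN k (x : F) : (- x) ^+ (3 ^ k) = - x ^+ (3 ^ k).
Proof. by rewrite exprNn -signr_odd oddX orbT mulN1r. Qed.

Lemma frob0 k : (0 : F) ^+ (3 ^ k) = 0.
Proof. by rewrite expr0n expn_eq0. Qed.

Lemma frobB k (x y : F) : (x - y) ^+ (3 ^ k) = x ^+ (3 ^ k) - y ^+ (3 ^ k).
Proof. by rewrite frobD frobN. Qed.

Lemma expf_m (x : F) : x ^+ (3 ^ m) = x.
Proof. by rewrite -hcard expf_card. Qed.

Lemma frobq3 (x : F) : ((x ^+ q) ^+ q) ^+ q = x.
Proof. by rewrite -!exprM -!expnD -[RHS]expf_m; congr (_ ^+ (3 ^ _)); lia. Qed.

Lemma trD x y : Tr (x + y) = Tr x + Tr y.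
Proof. by rewrite /absTr -big_split; apply: eq_bigr => i _; rewrite frobD. Qed.

Lemma trN x : Tr (- x) = - Tr x.
Proof. by rewrite /absTr -sumrN; apply: eq_bigr => i _; rewrite frobN. Qed.

Lemma tr0 : Tr 0 = 0.
Proof. by rewrite /absTr big1 // => i _; rewrite frob0. Qed.

Lemma tr_cube_in x : Tr (x ^+ 3) = Tr x.
Proof.
rewrite /absTr; case: m (expf_m x) => [|k] e; first by rewrite !big_ord0.
rewrite big_ord_recr big_ord_recl /= addrC; congr (_ + _).
  by rewrite -exprM -expnS e.
by apply: eq_bigr => i _; rewrite -exprM -expnS.
Qed.

Lemma tr_cube x : Tr x ^+ 3 = Tr x.
Proof.
rewrite -{2}tr_cube_in /absTr.
rewrite (big_morph (fun z => z ^+ 3) (frobD 1) (frob0 1)).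
by apply: eq_bigr => i _; rewrite -!exprM mulnC.
Qed.

Lemma tr_frob k x : Tr (x ^+ (3 ^ k)) = Tr x.
Proof.
elim: k x => [|k IHk] x; first by rewrite expr1.
by rewrite expnS exprM IHk tr_cube_in.
Qed.

Lemma tr_cases x : [\/ Tr x = 0, Tr x = 1 | Tr x = -1].
Proof.
have: Tr x * ((Tr x - 1) * (Tr x + 1)) == 0.
  by rewrite -subr_sqr expr1n mulrBr mulr1 -exprS tr_cube subrr.
rewrite !mulf_eq0 subr_eq0 addr_eq0.
by case/or3P => /eqP; [apply: Or31|apply: Or32|apply: Or33].
Qed.

(** The trace is a polynomial of degree [3 ^ m.-1], too small to vanish at all [3 ^ m] elements. *)
Lemma tr_neq0 : exists x, Tr x != 0.
Proof.
apply/existsP; rewrite -negb_forall; apply/negP => /forallP tr_eq0.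
pose p : {poly F} := \sum_(i < m) 'X^(3 ^ i).
have sp : size p = (3 ^ m.-1).+1.
  have : (0 < m)%N by have := h_gt0; lia.
  rewrite /p; case: m => // k _.
  rewrite big_ord_recr /= addrC size_polyDl ?size_polyXn //.
  apply: (leq_ltn_trans (size_sum _ _ _)); rewrite ltnS.
  by apply/bigmax_leqP => i _; rewrite size_polyXn ltn_exp2l.
have p0 : p != 0 by rewrite -size_poly_gt0 sp.
have: all (root p) (enum F).
  apply/allP => x _; rewrite rootE horner_sum.
  have := tr_eq0 x; rewrite /absTr; congr (_ == _).
  by apply: eq_bigr => i _; rewrite hornerXn.
move=> /(max_poly_roots p0) /(_ (enum_uniq F)).
rewrite -cardE hcard sp ltnS leq_exp2l //; have := h_gt0; lia.
Qed.

Lemma neg1_neq0 : (-1 : F) != 0.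
Proof. by rewrite oppr_eq0 oner_eq0. Qed.

Lemma neg1_neq1 : (-1 : F) != 1.
Proof.
apply: contra_neq (oner_neq0 F) => e.
have e2 : 1 + 1 = 0 :> F by rewrite -{1}e addNr.
by rewrite -three0 -[1 in LHS]add0r -e2; ring.
Qed.

(** The canonical additive character. Traces are elements of [F], so the exponent of [omega] is read
    off by cases; the last case is trace [-1]. *)
Definition psi (x : F) : algC :=
  if Tr x == 0 then 1 else if Tr x == 1 then omega else omega ^+ 2.

Lemma psiD x y : psi (x + y) = psi x * psi y.
Proof.
have w3 := omega3.
have e2 : (1 + 1 : F) = -1.
  by apply/eqP; rewrite -subr_eq0 -three0; apply/eqP; ring.
rewrite /psi trD; case: (tr_cases x) => ->; case: (tr_cases y) => ->;
  rewrite ?addr0 ?add0r ?subrr ?addNr ?e2 ?eqxx ?oner_eq0 ?(negPf neg1_neq0)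
    ?(negPf neg1_neq1) ?mulr1 ?mul1r // -?w3 //; try by ring.
rewrite (_ : -1 - 1 = 1 :> F) ?oner_eq0 ?eqxx; last first.
  by apply/eqP; rewrite -subr_eq0; apply/eqP; transitivity (- (3%:R) : F);
     [ring | rewrite three0 oppr0].
by transitivity (omega * omega ^+ 3); [rewrite w3 mulr1 | ring].
Qed.

Lemma psi0 : psi 0 = 1.
Proof. by rewrite /psi tr0 eqxx. Qed.

Lemma psiN x : psi (- x) = (psi x)^*.
Proof.
rewrite /psi trN; case: (tr_cases x) => ->;
 rewrite ?oppr0 ?opprK ?eqxx ?oner_eq0 ?(negPf neg1_neq0) ?(negPf neg1_neq1)
   ?rmorph1 ?rmorphXn /= ?omega_conj //.
by rewrite -exprM (exprD _ 3 1) omega3 mul1r.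
Qed.

Lemma psi_frob k x : psi (x ^+ (3 ^ k)) = psi x.
Proof. by rewrite /psi tr_frob. Qed.

Lemma psi_indicator x : 1 + psi x + psi (- x) = (3 * (Tr x == 0))%:R.
Proof.
rewrite /psi trN; case: (tr_cases x) => ->;
 rewrite ?oppr0 ?opprK ?eqxx ?oner_eq0 ?(negPf neg1_neq0) ?(negPf neg1_neq1) /=
  ?muln0 ?omega_sum //; first by rewrite muln1; ring.
by rewrite addrAC omega_sum.
Qed.

Lemma psi_sum a : \sum_x psi (a * x) = ((a == 0) * 3 ^ m)%:R.
Proof.
have [->|a0] := eqVneq a 0.
  rewrite (eq_bigr (fun=> 1)) => [|x _]; last by rewrite mul0r psi0.
  by rewrite sumr_const cardT -cardE hcard mul1n.
have [x0 tx0] := tr_neq0.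
have px0 : psi x0 != 1.
  rewrite /psi (negPf tx0); case: ifP => _.
    by rewrite -[omega]expr1 -(prim_order_dvd omega_prim).
  by rewrite -(prim_order_dvd omega_prim).
apply/eqP; rewrite mul0n; move: px0; rewrite -subr_eq0 => /mulfI inj.
apply/eqP/inj; rewrite mulr0 mulrBl mul1r mulr_sumr; apply/eqP; rewrite subr_eq0.
(* Translating by [x0 / a] multiplies the sum by [psi x0], which differs from 1. *)
apply/eqP; rewrite [RHS](reindex_inj (addIr (x0 / a))) /=.
by apply: eq_bigr => x _; rewrite mulrDr psiD mulrC mulrCA divff // mulr1.
Qed.


Variable alpha : F.
Hypothesis hgen : (3 ^ m - 1)%N.-primitive_root alpha.

Notation M := ((3 ^ m - 1) %/ 2)%N.
Notation l := (3 ^ (2 * h) - 3 ^ h + 1)%N.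

(** * From Weil sums to quadratic forms *)

(** This makes [M] odd: then [-1] is a non-square, and [y ^+ M], the quadratic character by Euler's
    criterion, is an odd function. *)
Lemma pow3_odd_mod8 n : odd n -> (3 ^ n %% 8 = 3)%N.
Proof.
move=> n_odd; rewrite -(odd_double_half n) n_odd expnD expn1 -mul2n expnM.
by rewrite -modnMmr -modnXm exp1n.
Qed.

Lemma m_odd : odd m.
Proof. by rewrite oddM. Qed.

Lemma M_double : (M + M).+1 = (3 ^ m)%N.
Proof. by have := pow3_odd_mod8 _ m_odd; lia. Qed.

Lemma M_odd : odd M.
Proof. by have := pow3_odd_mod8 _ m_odd; lia. Qed.

Lemma q2E : (3 ^ (2 * h) = q * q)%N.
Proof. by rewrite mulnC expnM. Qed.

Lemma q3E : (3 ^ m = q * q * q)%N.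
Proof. by rewrite mulnC expnM !expnS expn0 muln1 mulnA. Qed.

Lemma l_mul : (q.+1 * l = (3 ^ m).+1)%N.
Proof. by rewrite q2E q3E; have := q_gt1; nia. Qed.

Lemma l_odd : odd l.
Proof.
rewrite q2E addn1 /= oddB ?oddM ?oddX /= ?orbT //.
by rewrite leq_pmulr // expn_gt0.
Qed.

Lemma etaN (y : F) : (- y) ^+ M = - y ^+ M.
Proof. by rewrite exprNn -signr_odd M_odd mulN1r. Qed.

Lemma eta_cases (y : F) : y != 0 -> y ^+ M = 1 \/ y ^+ M = -1.
Proof.
move=> y0; have : (y ^+ M) ^+ 2 == 1.
  rewrite -exprM muln2 -addnn; apply/eqP/(mulfI y0).
  by rewrite -exprS M_double expf_m mulr1.
by rewrite sqrf_eq1 => /orP[] /eqP ->; [left|right].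
Qed.

Lemma alphaM : alpha ^+ M = -1.
Proof.
have a0 : alpha != 0 by rewrite (prim_root_eq0 hgen); have := M_double; have := M_odd; lia.
case: (eta_cases _ a0) => // e.
have M0 : (0 < M)%N by case: M M_odd.
have : (3 ^ m - 1 <= M)%N by apply: dvdn_leq => //; rewrite (prim_order_dvd hgen) e.
have := M_double; lia.
Qed.

Lemma neg1_not_square (x : F) : x ^+ 2 != -1.
Proof.
have [->|x0] := eqVneq x 0; first by rewrite expr0n eq_sym neg1_neq0.
apply: contra_neq neg1_neq1 => e.
have : (x ^+ 2) ^+ M = 1.
  by apply: (mulfI x0); rewrite -exprM mul2n -addnn -exprS M_double expf_m mulr1.
by rewrite e -signr_odd M_odd.
Qed.

Lemma expf_inj e : coprime e (3 ^ m - 1) -> (0 < e)%N -> injective (fun x : F => x ^+ e).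
Proof.
move=> co_e e0 x y /= exy.
have [u v uv _] := egcdnP (3 ^ m - 1) e0.
have inv z : (z : F) ^+ (u * e) = z.
  rewrite uv (eqP co_e) addn1 exprS mulnC exprM.
  have [-> | z0] := eqVneq z 0; first by rewrite mul0r.
  rewrite (_ : z ^+ (3 ^ m - 1) = 1) ?expr1n ?mulr1 //.
  by apply: (mulfI z0); rewrite -exprS subn1 prednK ?expn_gt0 // expf_m mulr1.
by rewrite -(inv x) -(inv y) mulnC !(exprM _ e) exy.
Qed.

(* [y |-> y ^+ M * y ^+ q.+1] sends squares to squares and non-squares to non-squares. *)
Lemma twist_inj : injective (fun y : F => y ^+ (M + q.+1)).
Proof.
apply: expf_inj; last by rewrite addnS.
rewrite [X in coprime _ X](_ : _ = (M * 2)%N); last by have := M_double; lia.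
have odd_q : odd q by rewrite oddX orbT.
rewrite coprimeMr coprimen2 oddD M_odd /= odd_q andbT /coprime gcdnC gcdnDl gcdnC.
set d := gcdn _ _.
have dM : (d %| M)%N := dvdn_gcdr _ _.
(* [d] divides [q.+1], hence also [q.+1 * l = 2 * M + 2]; as it divides [M], it divides 2, and [M]
   being odd leaves only 1. *)
have d2 : (d %| 2)%N.
  have : (d %| M + M + 2)%N.
    rewrite (_ : (M + M + 2)%N = (q.+1 * l)%N) ?dvdn_mulr ?dvdn_gcdl //.
    by rewrite l_mul -[in RHS]M_double; lia.
  by rewrite dvdn_addr ?dvdn_add.
have d_le := dvdn_leq (isT : 0 < 2)%N d2.
move: d_le d2 dM; case: d => [|[|[|d]]] //= _ _ /dvdnP [c].
by have := M_odd => /[swap] ->; lia.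
Qed.

Definition weil (b : F) : algC := \sum_x psi (x ^+ l + b * x).
Definition qform (b y : F) : F := y ^+ 2 + b * y ^+ q.+1.
Definition qsum (b : F) : algC := \sum_y psi (qform b y).

(** The sign [y ^+ M] is unchanged by the odd power [l], while [q.+1 * l = 3 ^ m + 1] turns
    [y ^+ q.+1] into [y ^+ 2]. *)
Lemma twist_powl (y : F) : (y ^+ (M + q.+1)) ^+ l = y ^+ M * y ^+ 2.
Proof.
have [->|y0] := eqVneq y 0.
  transitivity (0 ^+ l : F); last by rewrite addn1 !exprS !mul0r mulr0.
  by rewrite (expr0n _ (M + _)) (addnS M).
rewrite [y ^+ (M + _)]exprD exprMn -[(y ^+ q.+1) ^+ l]exprM l_mul exprS expf_m -expr2; congr (_ * _).
by case: (eta_cases _ y0) => ->; rewrite ?expr1n // -signr_odd l_odd.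
Qed.

(** For nonzero [y] the factor [y ^+ M] is a sign, which only permutes the two terms; the hypothesis
    covers [y = 0], where the factor vanishes. *)
Lemma psi_eta (y z : F) : (y == 0 -> z = 0) ->
  psi (y ^+ M * z) + psi (- (y ^+ M * z)) = psi z + psi (- z).
Proof.
have [->|y0 _] := eqVneq y 0; first by move/(_ isT) ->; rewrite mulr0.
by case: (eta_cases _ y0) => ->; rewrite ?mul1r // mulN1r opprK addrC.
Qed.

Lemma qformN b y : qform b (- y) = qform b y.
Proof. by rewrite /qform sqrrN exprNn -signr_odd /= oddX orbT /= mul1r. Qed.

Lemma weil_qsum b : weil b *+ 2 = qsum b + (qsum b)^*.
Proof.
have -> : weil b = \sum_y psi (y ^+ M * qform b y).
  rewrite /weil (reindex_inj twist_inj) /=; apply: eq_bigr => y _.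
  by rewrite twist_powl exprD /qform mulrDr (mulrCA b).
(* The second copy of the sum is reindexed by [-y]: the form is even and the character odd, so each
   pair of terms is independent of the sign [y ^+ M]. *)
rewrite mulr2n {2}(reindex_inj oppr_inj) -big_split /= /qsum rmorph_sum -big_split /=.
apply: eq_bigr => y _; rewrite qformN etaN mulNr psi_eta ?psiN // => /eqP ->.
by rewrite /qform !expr0n /= mulr0 addr0.
Qed.

Lemma weil_conj b : (weil b)^* = weil b.
Proof.
apply: (@pmulrnI _ 2 isT); rewrite /= -rmorphMn /= weil_qsum rmorphD /= conjCK addrC.
by [].
Qed.

(** As [alpha ^+ M = -1], the powers with exponent below [M] pick one element from each pair [x],
    [-x] of nonzero elements. *)
Lemma sum_half (V : nmodType) (f : F -> V) :
  \sum_y f y = f 0 + \sum_(0 <= t < M) (f (alpha ^+ t) + f (- alpha ^+ t)).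
Proof.
rewrite (bigD1 0) //=; congr (_ + _).
pose s := [seq alpha ^+ t | t <- iota 0 (M + M)].
have n2 : (3 ^ m - 1)%N = (M + M)%N by have := M_double; lia.
have a0 : alpha != 0 by rewrite (prim_root_eq0 hgen) n2; have := M_odd; case: M.
have us : uniq s.
  rewrite map_inj_in_uniq ?iota_uniq // => i j; rewrite !mem_iota => /= hi hj /eqP.
  by rewrite (eq_prim_root_expr hgen) n2 !modn_small //; move/eqP.
have sP x : (x \in s) = (x != 0).
  apply/mapP/idP => [[i _ ->]|x0]; first exact: expf_neq0.
  have /(prim_rootP hgen) [i ->] : x ^+ (3 ^ m - 1) = 1.
    by apply: (mulfI x0); rewrite -exprS subn1 prednK ?expn_gt0 // expf_m mulr1.
  by exists (val i) => //; rewrite mem_iota -n2 ltn_ord.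
rewrite (eq_bigl (mem s)) => [|x]; last by rewrite /= sP.
rewrite -big_uniq //= big_map iotaD big_cat /= big_split /=.
rewrite /index_iota subn0; congr (_ + _).
have -> : iota (0 + M) M = [seq (M + i)%N | i <- iota 0 M] by rewrite -iotaDl addnC.
rewrite big_map; apply: eq_bigr => i _.
by rewrite exprD alphaM mulN1r.
Qed.

Lemma psi_re x : exists c : int, psi x + psi (- x) = c%:~R.
Proof.
have e := psi_indicator x.
exists (Posz (3 * (Tr x == 0)) - 1).
by rewrite rmorphB /= -[RHS]/((3 * (Tr x == 0))%:R - 1) -e; ring.
Qed.

Lemma psi_im x : exists d : int, psi x - psi (- x) = d%:~R * (omega - omega ^+ 2).
Proof.
rewrite /psi trN; case: (tr_cases x) => ->;
 rewrite ?oppr0 ?opprK ?eqxx ?oner_eq0 ?(negPf neg1_neq0) ?(negPf neg1_neq1).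
- by exists 0; rewrite mul0r subrr.
- by exists 1; rewrite mul1r.
- by exists (-1); rewrite mulN1r opprB.
Qed.

(** The form is even, so [qsum b = 1 + 2 A] with [A] a sum over half of the nonzero elements. [A]
    plus its conjugate is an integer and [A] minus its conjugate an integer multiple of
    [omega - omega ^+ 2], so both coordinates are free of halves. *)
Lemma weil_norm_form b : exists s k : int,
  weil b = s%:~R /\ qsum b * (qsum b)^* = (s ^+ 2 + 3 * k ^+ 2)%:~R.
Proof.
pose A : algC := \sum_(0 <= t < M) psi (qform b (alpha ^+ t)).
have qA : qsum b = 1 + A *+ 2.
  rewrite /qsum sum_half {1}/qform !expr0n /= mulr0 addr0 psi0 -sumrMnl.
  by congr (_ + _); apply: eq_bigr => t _; rewrite qformN mulr2n.
have Ac : A^* = \sum_(0 <= t < M) psi (- qform b (alpha ^+ t)).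
  by rewrite rmorph_sum; apply: eq_bigr => t _; rewrite psiN.
have [c cE] : exists c : int, A + A^* = c%:~R.
  rewrite Ac /A -big_split /=; elim: (index_iota _ _) => [|t r [c IHr]].
    by exists 0; rewrite big_nil.
  have [d dE] := psi_re (qform b (alpha ^+ t)).
  by exists (d + c); rewrite big_cons dE IHr rmorphD.
have [k kE] : exists k : int, A - A^* = k%:~R * (omega - omega ^+ 2).
  rewrite Ac /A -sumrB /=; elim: (index_iota _ _) => [|t r [k IHr]].
    by exists 0; rewrite big_nil mul0r.
  have [d dE] := psi_im (qform b (alpha ^+ t)).
  by exists (d + k); rewrite big_cons dE IHr rmorphD mulrDl.
have wE : weil b = 1 + (A + A^*).
  apply: (@pmulrnI _ 2 isT); rewrite /= weil_qsum qA rmorphD rmorphMn rmorph1 /=.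
  by rewrite !mulr2n addrACA [RHS]addrACA (addrACA A).
exists (1 + c), k; rewrite wE cE rmorphD /=; split => //.
have k2 : 3%:R * k%:~R ^+ 2 = - (A - A^*) ^+ 2.
  rewrite kE [in RHS]exprMn -mulrN [LHS]mulrC; congr (_ * _).
  by apply: oppr_inj; rewrite opprK; exact/esym/omega_sub_sqr.
rewrite qA rmorphD rmorph1 rmorphMn /=.
transitivity ((1 + (A + A^*)) ^+ 2 - (A - A^*) ^+ 2).
  exact: mul_double_succ.
rewrite -k2 [1 + _](_ : _ = (1 + c)%:~R); last by rewrite rmorphD rmorph1 /= -cE.
by rewrite !(rmorphD, rmorphM, rmorphXn).
Qed.

(** * The radical and the values of the Weil sum *)

(** Polarising [Tr (qform b y)] gives the pairing [Tr (radop b w * z)], whose radical is the kernel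
    of [radop b]. *)
Definition radop (b y : F) : F := 2%:R * y + b * y ^+ q + (b * y) ^+ (3 ^ (2 * h)).
Definition radical (b : F) : {set F} := [set y | radop b y == 0].

Lemma frobq2 (x : F) : x ^+ (3 ^ (2 * h)) = (x ^+ q) ^+ q.
Proof. by rewrite q2E exprM. Qed.

Lemma psi_cube x : psi x ^+ 3 = 1.
Proof.
rewrite /psi; case: ifP => _; first by rewrite expr1n.
by case: ifP => _; rewrite -?exprM 1?mulnC ?exprM omega3 ?expr1n.
Qed.

(** Raising [b * z ^+ q * w] to the power [q ^ 2] keeps its trace and, as [z ^+ (q ^ 3) = z], frees
    [z] of its exponent. *)
Lemma psi_adjoint b z w :
  psi (b * (z ^+ q * w + z * w ^+ q)) = psi (z * (b * w ^+ q + (b * w) ^+ (3 ^ (2 * h)))).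
Proof.
rewrite !mulrDr !psiD mulrC; congr (_ * _); first by rewrite mulrCA.
rewrite -(psi_frob (2 * h)) mulrCA (exprMn _ (z ^+ q)); congr psi.
by rewrite !frobq2 frobq3.
Qed.

Lemma qformD b z w :
  psi (qform b (z + w)) = psi (qform b z) * (psi (qform b w) * psi (radop b w * z)).
Proof.
have -> : radop b w * z = 2%:R * w * z + z * (b * w ^+ q + (b * w) ^+ (3 ^ (2 * h))).
  by rewrite /radop -addrA mulrDl (mulrC z).
rewrite (psiD (2%:R * w * z)) -psi_adjoint -!psiD; congr psi.
by rewrite /qform !(exprSr _ q) frobD; ring.
Qed.

(** Pairing [w] with [radop b w = 0] shows that the square of the value is 1; so is its cube. *)
Lemma psi_qform_radical b w : w \in radical b -> psi (qform b w) = 1.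
Proof.
rewrite inE => /eqP e.
have p2 : psi (qform b w) ^+ 2 = 1.
  rewrite -psi0 -(mulr0 w) -e /radop -addrA mulrDr [RHS]psiD -psi_adjoint -[RHS]psiD expr2 -psiD.
  by congr psi; rewrite /qform !(exprSr _ q); ring.
by have := psi_cube (qform b w); rewrite exprS p2 mulr1.
Qed.

Lemma qsum_norm b : qsum b * (qsum b)^* = (3 ^ m * #|radical b|)%:R.
Proof.
rewrite /qsum mulrC rmorph_sum mulr_suml.
transitivity (\sum_z \sum_w psi (qform b w) * psi (radop b w * z)).
  (* Substituting [z + w] for the second variable leaves a character in [z], whose sum vanishes
     unless [w] lies in the radical. *)
  apply: eq_bigr => z _; rewrite (reindex_inj (addrI z)) mulr_sumr /=.
  apply: eq_bigr => w _; by rewrite qformD -psiN !mulrA -(psiD (- qform b z)) addNr psi0 mul1r.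
rewrite exchange_big /= (eq_bigr (fun w => ((w \in radical b) * 3 ^ m)%:R)) => [|w _].
  by rewrite -natr_sum -big_distrl /= -sum1_card [in RHS]big_mkcond mulnC.
rewrite -mulr_sumr psi_sum inE; case: eqP => [e|_]; last by rewrite mulr0.
by rewrite psi_qform_radical ?mul1r // inE e.
Qed.

Lemma card_root_lt (p : {poly F}) (A : {set F}) :
  p != 0 -> {in A, forall x, root p x} -> (#|A| < size p)%N.
Proof.
move=> p0 pA; rewrite cardE; apply: max_poly_roots; rewrite ?enum_uniq //.
by apply/allP => x; rewrite mem_enum; exact: pA.
Qed.

(** The subfield of order [q], over which [radop b] is linear. *)
Definition subF : {set F} := [set x | x ^+ q == x].

Lemma card_subF : #|subF| = q.
Proof.
have q1 := q_gt1.
apply/eqP; rewrite eqn_leq; apply/andP; split.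
  have sp : size ('X^q - 'X : {poly F}) = q.+1.
    by rewrite size_polyDl size_polyXn // size_polyN size_polyX ltnS; lia.
  rewrite -ltnS -sp; apply: card_root_lt; first by rewrite -size_poly_gt0 sp.
  by move=> x; rewrite inE rootE !hornerE subr_eq0.
have dq : (q.-1 %| 3 ^ m - 1)%N.
  by apply/dvdnP; exists (q * q + q + 1)%N; rewrite q3E; nia.
(* For the lower bound, [q] elements are exhibited: 0 and the powers of an element of order
   [q.-1]. *)
pose beta := alpha ^+ ((3 ^ m - 1) %/ q.-1).
have bP : q.-1.-primitive_root beta := dvdn_prim_root hgen dq.
pose s := 0 :: [seq beta ^+ i | i <- iota 0 q.-1].
have ss : size s = q by rewrite /= size_map size_iota; lia.
have b0 : beta != 0 by rewrite (prim_root_eq0 bP); lia.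
have us : uniq s.
  rewrite /= map_inj_in_uniq ?iota_uniq ?andbT => [|i j].
    by apply/mapP => -[i _ /eqP]; rewrite eq_sym expf_eq0 (negPf b0) andbF.
  rewrite !mem_iota => /= hi hj /eqP.
  by rewrite (eq_prim_root_expr bP) !modn_small //; move/eqP.
rewrite -{1}ss -(card_uniqP us); apply/subset_leq_card/subsetP => x.
rewrite !inE => /orP[/eqP ->|/mapP [i _ ->]]; first by rewrite frob0.
rewrite -(prednK (ltnW (ltnW q1))) exprS -[(beta ^+ i) ^+ _]exprM (mulnC i) exprM (prim_expr_order bP).
by rewrite expr1n mulr1.
Qed.

Lemma radopD b y z : radop b (y + z) = radop b y + radop b z.
Proof. by rewrite /radop frobD mulrDr (mulrDr b y z) frobD; ring. Qed.

Lemma radopZ b s y : s \in subF -> radop b (s * y) = s * radop b y.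
Proof.
rewrite inE => /eqP e; rewrite /radop !exprMn (frobq2 s) !e; ring.
Qed.

(** For nonzero [b] the radical consists of roots of a polynomial of degree [q * q]; for [b = 0] the
    operator is multiplication by 2. *)
Lemma card_radical_le b : (#|radical b| <= q * q)%N.
Proof.
have q1 := q_gt1.
pose p : {poly F} := 2%:R *: 'X + b *: 'X^q + (b ^+ (q * q)) *: 'X^(q * q).
have [->|b0] := eqVneq b 0.
  apply: (@leq_trans #|[set (0 : F)]|); last by rewrite cards1; nia.
  apply/subset_leq_card/subsetP => y; rewrite !inE /radop !mul0r frob0 !addr0.
  rewrite mulf_eq0 => /orP[/eqP e|//]; have := oner_neq0 F.
  by rewrite -three0 (natrD _ 2 1) e add0r eqxx.
have sp : size p = (q * q).+1.
  rewrite /p addrC size_polyDl ?size_scale ?expf_neq0 // size_polyXn //.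
  rewrite ltnS; apply: leq_trans (size_polyD _ _) _; rewrite geq_max.
  rewrite (leq_trans (size_scale_leq _ _)) ?(leq_trans (size_scale_leq _ _)) //.
    by rewrite size_polyXn; nia.
  by rewrite size_polyX; nia.
rewrite -ltnS -sp; apply: card_root_lt; first by rewrite -size_poly_gt0 sp.
move=> y; rewrite inE /radop rootE !hornerE q2E exprMn.
by [].
Qed.

(** The radical is a [subF]-subspace: two independent elements already span [q * q] of its elements,
    and [card_radical_le] allows no more. *)
Lemma card_radical b : [\/ radical b = [set 0], #|radical b| = q | #|radical b| = (q * q)%N].
Proof.
have r0 : 0 \in radical b by rewrite inE /radop frob0 !mulr0 frob0 !addr0.
have [e|] := boolP (radical b \subset [set 0]).
  by apply: Or31; apply/eqP; rewrite eqEsubset e sub1set.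
case/subsetPn => y yr; rewrite inE => y0.
have [e|] := boolP (radical b \subset [set s * y | s in subF]).
  apply: Or32; rewrite -card_subF -(card_imset (fun s => s \in subF) (mulIf y0)).
  apply: eq_card => z; apply/idP/imsetP => [/(subsetP e) /imsetP //|[s sF ->]].
  by move: yr; rewrite !inE radopZ // => /eqP ->; rewrite mulr0.
case/subsetPn => z zr zy; apply: Or33; apply/eqP; rewrite eqn_leq card_radical_le.
rewrite -card_subF -cardsX.
have inj : {in setX subF subF &, injective (fun u : F * F => u.1 * y + u.2 * z)}.
  move=> [s t] [s' t']; rewrite !inE /= => /andP[/eqP sF /eqP tF] /andP[/eqP sF' /eqP tF'] e.
  have e' : (t - t') * z = (s' - s) * y.
    transitivity (s * y + t * z - s * y - t' * z); first by ring.
    by rewrite e /=; ring.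
  have tt : t = t'.
    apply/eqP; rewrite -subr_eq0; apply: contraNT zy => tt.
    apply/imsetP; exists ((s' - s) / (t - t')).
      by rewrite inE exprMn exprVn !frobB sF tF sF' tF'.
    by apply: (mulfI tt); rewrite e'; field.
  move: e'; rewrite tt subrr mul0r => /esym/eqP; rewrite mulf_eq0 (negPf y0) orbF.
  by rewrite subr_eq0 => /eqP ->.
rewrite -(card_in_imset inj); apply/subset_leq_card/subsetP => x /imsetP [[s t]].
rewrite in_setX => /andP[/= sF tF] ->.
by move: yr zr; rewrite !inE radopD !radopZ // => /eqP -> /eqP ->; rewrite !mulr0 addr0.
Qed.

(** The norm of [qsum b] is a power of 3 with exponent [m], [m + h] or [m + 2 h]. As [m] and [h] are
    odd, only the middle one is even, and its half is [2 h]; [norm_form_pow3] then decides. *)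
Lemma weil_value b : weil b = 0 \/
  (exists2 w, w != 0 & radop b w = 0) /\ (weil b = (q ^ 2)%:R \/ weil b = - (q ^ 2)%:R).
Proof.
have [s [k [sE]]] := weil_norm_form b; rewrite qsum_norm sE => nE.
have main n : (3 ^ m * #|radical b|)%N = (3 ^ n)%N -> if odd n then s = 0 else (s == 3 ^+ n./2) || (s == - 3 ^+ n./2).
  move=> e; have nf : s ^+ 2 + 3 * k ^+ 2 = 3 ^+ n.
    by apply: (@intr_inj algC); rewrite -nE e rmorphXn natrX.
  have := norm_form_pow3 _ _ _ nf; case: ifP => // on k0.
  rewrite -eqf_sqr -exprM muln2 even_halfK ?on //.
  by rewrite -nf k0 expr0n mulr0 addr0.
have mo := m_odd.
case: (card_radical b) => e.
- left; have := main m; rewrite e cards1 muln1 mo => -> //.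
- right; split.
    have : (1 < #|radical b|)%N by rewrite e; have := q_gt1; lia.
    case/card_gt1P => x [y [xr yr xy]].
    have [x0|x0] := eqVneq x 0.
      by exists y; [rewrite -x0 eq_sym | move: yr; rewrite inE => /eqP].
    by exists x => //; move: xr; rewrite inE => /eqP.
  have := main (m + h)%N; rewrite e expnD oddD mo hodd (_ : (m + h)./2 = (h * 2)%N); last by lia.
  by move=> /(_ erefl) /orP[] /eqP ->; [left|right]; rewrite ?rmorphN rmorphXn /= natrX exprM natrX.
- left; have := main (m + h + h)%N; rewrite e !expnD mulnA (oddD (m + h)) (oddD m) mo hodd => -> //.
Qed.

(** The radical equation and its two conjugates under the [q]-power map form a linear system with
    the nonzero solution [w], [w ^+ q], [(w ^+ q) ^+ q]. The conclusion says that its determinant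
    vanishes, with 2 written as -1. *)
Lemma radical_disc b w : w != 0 -> radop b w = 0 ->
  b ^+ 2 + (b ^+ q) ^+ 2 + ((b ^+ q) ^+ q) ^+ 2 - b * b ^+ q * (b ^+ q) ^+ q = 1.
Proof.
move=> w0 e1.
have two : 2%:R = -1 :> F.
  by apply/eqP; rewrite -addr_eq0 -(natrD _ 2 1) three0.
have E1 : - w + b * w ^+ q + (b ^+ q) ^+ q * (w ^+ q) ^+ q = 0.
  by rewrite -e1 /radop frobq2 !exprMn two mulN1r.
have E2 : - w ^+ q + b ^+ q * (w ^+ q) ^+ q + b * w = 0.
  by have := congr1 (fun z => z ^+ q) E1; rewrite frob0 !frobD frobN !exprMn !frobq3.
have E3 : - (w ^+ q) ^+ q + (b ^+ q) ^+ q * w + b ^+ q * w ^+ q = 0.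
  by have := congr1 (fun z => z ^+ q) E2; rewrite frob0 !frobD frobN !exprMn !frobq3.
move: (b ^+ q) E1 E2 E3 => b'; move: (b' ^+ q) (w ^+ q) => b'' w'.
move: (w' ^+ q) => w'' E1 E2 E3.
apply/eqP; rewrite -subr_eq0; apply/eqP/(mulIf w0).
(* Cramer's rule: the first row of the adjugate of the matrix of the system [E1, E2, E3]. *)
transitivity ((1 - b' ^+ 2) * (- w + b * w' + b'' * w'')
  + (b + b' * b'') * (- w' + b' * w'' + b * w)
  + (b * b' + b'') * (- w'' + b'' * w + b' * w') + 3%:R * (b * b' * b'' * w) * (-1)).
  by ring.
by rewrite E1 E2 E3 three0 !mul0r !mulr0 !addr0.
Qed.

Lemma weil_neq0_disc b : weil b != 0 ->
  b ^+ 2 + (b ^+ q) ^+ 2 + ((b ^+ q) ^+ q) ^+ 2 - b * b ^+ q * (b ^+ q) ^+ q = 1.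
Proof. by case: (weil_value b) => [->|[[w w0 e] _] _]; [rewrite eqxx | exact: radical_disc e]. Qed.

(* Adding the two discriminant equations gives [T ^+ 2 = -1] for the relative trace [T] of [a]. *)
Lemma weil_excl a : weil (1 + a) != 0 -> weil (1 - a) = 0.
Proof.
move=> /weil_neq0_disc e1; apply/eqP; apply: contraT => /weil_neq0_disc e2.
have /negP [] := neg1_not_square (a + a ^+ q + (a ^+ q) ^+ q).
move: e1 e2; rewrite !frobB !frobD !expr1n.
move: (a ^+ q) => a'; move: (a' ^+ q) => a'' e1 e2.
have e : 1 + 1 = _ := esym (congr2 +%R e1 e2).
apply/eqP/(addIr (1 + 1)); rewrite {1}e.
transitivity (3%:R * (1 + a ^+ 2 + a' ^+ 2 + a'' ^+ 2) + 1 : F); first by ring.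
by rewrite three0; ring.
Qed.

(** At [b = 1] the determinant equation would read [1 + 1 = 1]. *)
Lemma weil1 : weil 1 = 0.
Proof.
apply/eqP; apply: contraT => /weil_neq0_disc /eqP.
rewrite !expr1n !mul1r addrK -(natrD _ 1 1) -subr_eq0 addrK.
by rewrite oner_eq0.
Qed.

(** * Moments of the Weil sum *)

Lemma weil_sum : \sum_b weil b = (3 ^ m)%:R.
Proof.
rewrite exchange_big /= (bigD1 0) //= [X in _ + X]big1 ?addr0 => [|x x0].
  rewrite (eq_bigr (fun=> 1)) => [|b _].
    by rewrite sumr_const cardT -cardE hcard.
  by rewrite mulr0 addr0 addn1 expr0n psi0.
rewrite (eq_bigr (fun b => psi (x ^+ l) * psi (x * b))) => [|b _].
  by rewrite -mulr_sumr psi_sum (negPf x0) mul0n mulr0.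
by rewrite psiD (mulrC b).
Qed.

Lemma weil_sqr_sum : \sum_b weil b ^+ 2 = (3 ^ m * 3 ^ m)%:R.
Proof.
transitivity (\sum_b \sum_x \sum_y psi (x ^+ l - y ^+ l) * psi ((x - y) * b)).
  (* The sum is real, so one factor may be conjugated; summing over [b] then leaves the diagonal
     [x = y]. *)
  apply: eq_bigr => b _; rewrite expr2 -{2}weil_conj /weil rmorph_sum mulr_suml.
  apply: eq_bigr => x _; rewrite mulr_sumr; apply: eq_bigr => y _ /=.
  by rewrite -psiN -!psiD; congr psi; ring.
rewrite exchange_big /= (eq_bigr (fun=> (3 ^ m)%:R)) => [|x _].
  by rewrite sumr_const cardT -cardE hcard -mulrnA.
rewrite exchange_big /= (bigD1 x) //= [X in _ + X]big1 ?addr0 => [|y yx].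
  by rewrite -mulr_sumr psi_sum !subrr eqxx psi0 mul1n mul1r.
by rewrite -mulr_sumr psi_sum subr_eq0 eq_sym (negPf yx) mul0n mulr0.
Qed.

Definition weil_pos : {set F} := [set b | weil b == (q ^ 2)%:R].
Definition weil_neg : {set F} := [set b | weil b == - (q ^ 2)%:R].

Lemma q2_neq0 : (q ^ 2)%:R != 0 :> algC.
Proof. by rewrite pnatr_eq0 expn_eq0 expn_eq0. Qed.

Lemma q2_neqN : ((q ^ 2)%:R == - (q ^ 2)%:R :> algC) = false.
Proof. by rewrite -addr_eq0 -natrD pnatr_eq0 addnn double_eq0 !expn_eq0. Qed.

Lemma weilE b : weil b = (q ^ 2)%:R * ((b \in weil_pos)%:R - (b \in weil_neg)%:R).
Proof.
rewrite !inE; case: (weil_value b) => [->|[_ [->|->]]].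
- by rewrite eq_sym (negPf q2_neq0) eq_sym oppr_eq0 (negPf q2_neq0) subrr mulr0.
- by rewrite eqxx q2_neqN subr0 mulr1.
- by rewrite eqxx eq_sym q2_neqN sub0r mulrN1.
Qed.

Lemma weil_pos_neg b : (b \in weil_pos) && (b \in weil_neg) = false.
Proof. by rewrite !inE; case: eqP => //= ->; rewrite q2_neqN. Qed.

Lemma sum_mem (A : {set F}) : \sum_b (b \in A)%:R = #|A|%:R :> algC.
Proof. by rewrite -natr_sum -sum1_card [in RHS]big_mkcond. Qed.

Lemma card_weil_diff : #|weil_pos| = (#|weil_neg| + q)%N.
Proof.
have := weil_sum; rewrite (eq_bigr _ (fun b _ => weilE b)) -mulr_sumr sumrB !sum_mem.
rewrite q3E mulnn natrM => /(mulfI q2_neq0) e.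
by apply/eqP; rewrite -(eqr_nat algC) natrD -e addrC subrK.
Qed.

Lemma card_weil_add : (#|weil_pos| + #|weil_neg| = q * q)%N.
Proof.
have := weil_sqr_sum.
rewrite (eq_bigr (fun b => (q ^ 2)%:R ^+ 2 * ((b \in weil_pos)%:R + (b \in weil_neg)%:R))) => [|b _].
  rewrite -mulr_sumr big_split /= !sum_mem -natrD q3E.
  rewrite (_ : (q * q * q * (q * q * q))%N = ((q ^ 2) * (q ^ 2) * (q * q))%N); last by nia.
  rewrite natrM natrM -expr2 => /(mulfI (expf_neq0 2 q2_neq0)) e.
  by apply/eqP; rewrite -(eqr_nat algC) e.
rewrite weilE exprMn; congr (_ * _).
by case: (b \in _) (b \in _) (weil_pos_neg b) => [] [] //= _;
  rewrite ?subr0 ?sub0r ?addr0 ?add0r ?sqrrN ?expr1n ?expr0n.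
Qed.

(** * Weights of the code *)

Notation D := (defSet h alpha).
Notation zeroTr x := (Tr (x + x ^+ l) == 0).

Lemma zeroTrN x : zeroTr (- x) = zeroTr x.
Proof. by rewrite exprNn -signr_odd l_odd mulN1r -opprD trN oppr_eq0. Qed.

(** [D] lists one of each pair [x], [-x] of nonzero solutions, so a sign-invariant count over all
    solutions is twice that over [D], plus the contribution of 0. *)
Lemma sum_defSet (p : pred F) : (forall x, p (- x) = p x) ->
  #|[set x | zeroTr x && p x]| = (p 0%R + (count p D).*2)%N.
Proof.
move=> pN; rewrite -sum1dep_card big_mkcond /=.
rewrite [LHS](@sum_half nat (fun x => if zeroTr x && p x then 1%N else 0%N)).
rewrite (_ : zeroTr 0 = true); last first.
  by rewrite add0r expr0n addn1 tr0 eqxx.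
rewrite /=; congr (_ + _)%N.
rewrite -sum1_count /defSet big_map big_filter_cond /=.
rewrite -muln2 big_distrl /= /index_iota subn0 [RHS]big_mkcond.
apply: (@eq_bigr nat 0%N addn) => t _.
by rewrite zeroTrN pN exprM; case: ifP.
Qed.

(** The nontrivial characters contribute [weil 1] and its conjugate, both zero. *)
Lemma card_zeroTr : (3 * #|[set x | zeroTr x]|)%N = (3 ^ m)%N.
Proof.
apply/eqP; rewrite -(eqr_nat algC) mulnC -sum1dep_card big_mkcond /= big_distrl /= natr_sum.
rewrite (eq_bigr (fun x => 1 + psi (x ^+ l + 1 * x) + (psi (x ^+ l + 1 * x))^*)) => [|x _].
  rewrite !big_split /= sumr_const cardT -cardE hcard -rmorph_sum -/(weil 1) weil1.
  by rewrite rmorph0 !addr0.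
by rewrite -psiN psi_indicator mul1r addrC mulnC; case: ifP.
Qed.

Lemma card_codeword_support (a : F) : a != 0 ->
  (9 * #|[set x | zeroTr x && (Tr (a * x) != 0)]|)%:R
    = (2 * 3 ^ m)%:R - (weil (1 + a) + weil (1 - a)) *+ 2.
Proof.
move=> a0; rewrite -sum1dep_card big_mkcond /= big_distrr /= natr_sum.
pose u (x : F) := x ^+ l + 1 * x.
have wE c : \sum_x psi (u x + c * x) = weil (1 + c).
  by apply: eq_bigr => x _; rewrite /u -addrA -mulrDl.
have wN c : \sum_x psi (- (u x + c * x)) = weil (1 + c).
  by rewrite -weil_conj -wE rmorph_sum; apply: eq_bigr => x _; rewrite psiN.
(* The terms [0 * x] let [wE] and [wN] apply at [c = 0], where [weil 1] appears. *)
transitivity (\sum_x (2%:R * (1 + psi (u x + 0 * x) + psi (- (u x + 0 * x)))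
   - (psi (a * x) + psi (- a * x))
   - (psi (u x + a * x) + psi (u x + (- a) * x) + psi (- (u x + a * x)) + psi (- (u x + (- a) * x))))).
  apply: eq_bigr => x _.
  (* Each summand is three times the indicator of the defining condition times three times the
     indicator of [Tr (a * x) != 0], whence the factor 9. *)
  transitivity ((1 + psi (u x) + psi (- u x)) * (3%:R - (1 + psi (a * x) + psi (- (a * x))))).
    rewrite !psi_indicator /u mul1r (addrC (x ^+ l)).
    by case: (zeroTr x) => /=; case: (Tr (a * x) == 0) => /=; rewrite ?muln0 ?muln1 ?mul0r ?subrr ?mulr0 ?subr0 -?natrM.
  rewrite mul0r addr0 !mulNr !opprD !opprK !psiD.
  by ring.
rewrite !(sumrB, big_split) /= -mulr_sumr !(sumrB, big_split) /= !wE !wN !psi_sum.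
rewrite oppr_eq0 (negPf a0) !mul0n sumr_const cardT -cardE hcard addr0 weil1.
rewrite natrM; ring.
Qed.

Lemma q2_9 : (q * q = 9 * 3 ^ (2 * h - 2))%N.
Proof. by rewrite -q2E -(expnD 3 2); congr (_ ^ _)%N; have := h_gt0; lia. Qed.

Lemma q3_9 : (q * q * q = 9 * 3 ^ (3 * h - 2))%N.
Proof. by rewrite -q3E -(expnD 3 2); congr (_ ^ _)%N; have := h_gt0; lia. Qed.

Lemma size_defSet : size D = ((3 ^ (3 * h - 1) - 1) %/ 2)%N.
Proof.
have e : (3 ^ m = 3 * 3 ^ (3 * h - 1))%N by rewrite -expnS; congr (_ ^ _)%N; have := h_gt0; lia.
have := sum_defSet xpredT (fun=> erefl); rewrite count_predT.
have := card_zeroTr; rewrite e => /eqP; rewrite eqn_pmul2l // => /eqP.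
rewrite (eq_card (B := [set x | zeroTr x && true])) => [-> ->|x]; last by rewrite !inE andbT.
by rewrite /=; lia.
Qed.

Notation cw a := (codeword m D a).

Lemma wt_codeword a : wt (cw a) = count (fun d => Tr (a * d) != 0) D.
Proof.
rewrite /wt -sum1dep_card -sum1_count (big_nth 0) big_mkord.
by apply: eq_bigl => i; rewrite ffunE.
Qed.

Lemma wt_codeword_weil (a : F) : a != 0 ->
  (9 * wt (cw a))%:R = (3 ^ m)%:R - (weil (1 + a) + weil (1 - a)).
Proof.
move=> a0; apply: (@pmulrnI _ 2 isT) => /=.
have := card_codeword_support _ a0.
rewrite sum_defSet => [|x]; last by rewrite mulrN trN oppr_eq0.
rewrite mulr0 tr0 eqxx add0n -wt_codeword -muln2 mulnA => e.
by rewrite -[LHS]mulr_natr -natrM e mulrnBl natrM mulr_natl.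
Qed.

(** The Weil values enter the weight with a minus sign, so negative ones make a codeword heavy and
    positive ones light. *)
Definition heavy : {set F} := [set a | (1 + a \in weil_neg) || (1 - a \in weil_neg)].
Definition light : {set F} := [set a | (1 + a \in weil_pos) || (1 - a \in weil_pos)].

Lemma weil_signs b :
  [\/ [/\ b \in weil_pos, (b \in weil_neg) = false & weil b = (q ^ 2)%:R],
      [/\ (b \in weil_pos) = false, b \in weil_neg & weil b = - (q ^ 2)%:R]
    | [/\ (b \in weil_pos) = false, (b \in weil_neg) = false & weil b = 0]].
Proof.
have := weilE b; have := weil_pos_neg b.
case: (b \in weil_pos) (b \in weil_neg) => [] [] //= _ e.
- by apply: Or31; split => //; rewrite e subr0 mulr1.
- by apply: Or32; split => //; rewrite e sub0r mulrN1.
- by apply: Or33; split => //; rewrite e subr0 mulr0.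
Qed.

Lemma weil_signs_excl a : (1 + a \in weil_pos :|: weil_neg) && (1 - a \in weil_pos :|: weil_neg) = false.
Proof.
apply/andP => -[]; rewrite !inE => p1.
have /weil_excl -> : weil (1 + a) != 0.
  by case/orP: p1 => /eqP ->; rewrite ?oppr_eq0 q2_neq0.
by rewrite eq_sym (negPf q2_neq0) eq_sym oppr_eq0 (negPf q2_neq0).
Qed.

(** At most one of [weil (1 + a)] and [weil (1 - a)] is nonzero, which leaves three weights. The
    light case is stated additively to avoid truncated subtraction. *)
Lemma wt_cases (a : F) : a != 0 ->
  [\/ [/\ a \in light, (a \in heavy) = false & (wt (cw a) + 3 ^ (2 * h - 2) = 3 ^ (3 * h - 2))%N],
      [/\ (a \in light) = false, a \in heavy & (wt (cw a) = 3 ^ (3 * h - 2) + 3 ^ (2 * h - 2))%N]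
    | [/\ (a \in light) = false, (a \in heavy) = false & wt (cw a) = (3 ^ (3 * h - 2))%N]].
Proof.
move=> a0; have := wt_codeword_weil _ a0; have := weil_signs_excl a.
have lE : (a \in light) = (1 + a \in weil_pos) || (1 - a \in weil_pos) by rewrite inE.
have hE : (a \in heavy) = (1 + a \in weil_neg) || (1 - a \in weil_neg) by rewrite inE.
rewrite lE hE !in_setU.
have q2 := q2_9; have := q3_9; rewrite -q3E => q3.
have pos : (9 * wt (cw a))%:R = (3 ^ m)%:R - (q ^ 2)%:R :> algC ->
    (wt (cw a) + 3 ^ (2 * h - 2) = 3 ^ (3 * h - 2))%N.
  by move/eqP; rewrite eq_sym subr_eq -natrD eqr_nat -mulnn => /eqP; lia.
have neg : (9 * wt (cw a))%:R = (3 ^ m)%:R + (q ^ 2)%:R :> algC ->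
    (wt (cw a) = 3 ^ (3 * h - 2) + 3 ^ (2 * h - 2))%N.
  by move/eqP; rewrite -natrD eqr_nat -mulnn => /eqP; lia.
have zer : (9 * wt (cw a))%:R = (3 ^ m)%:R :> algC -> wt (cw a) = (3 ^ (3 * h - 2))%N.
  by move/eqP; rewrite eqr_nat => /eqP; lia.
case: (weil_signs (1 + a)) => -[-> -> ->];
  case: (weil_signs (1 - a)) => -[-> -> ->] //= _; rewrite ?addr0 ?add0r ?opprK ?subr0 => e.
- by apply: Or31; split => //; exact: pos.
- by apply: Or32; split => //; exact: neg.
- by apply: Or31; split => //; exact: pos.
- by apply: Or32; split => //; exact: neg.
- by apply: Or33; split => //; exact: zer.
Qed.

(** The set is the union of the preimages of [A] under the bijections [1 + a] and [1 - a], disjoint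
    by hypothesis. *)
Lemma card_shift (A : {set F}) :
  (forall a, (1 + a \in A) && (1 - a \in A) = false) ->
  #|[set a | (1 + a \in A) || (1 - a \in A)]| = (#|A|.*2)%N.
Proof.
move=> dis.
pose f (a : F) := 1 + a; pose g (a : F) := 1 - a.
have fi : injective f by apply: addrI.
have gi : injective g by move=> x y /addrI /oppr_inj.
have -> : [set a | (1 + a \in A) || (1 - a \in A)] = (f @^-1: A) :|: (g @^-1: A).
  by apply/setP => a; rewrite !inE.
rewrite cardsU (_ : _ :&: _ = set0) ?cards0 ?subn0; last first.
  by apply/setP => a; rewrite !inE; exact: dis.
rewrite -addnn; congr (_ + _)%N; rewrite on_card_preimset //; apply: onW_bij; exact: injF_bij.
Qed.

Lemma card_light : #|light| = (3 ^ (2 * h) + 3 ^ h)%N.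
Proof.
rewrite card_shift => [|a]; first by rewrite q2E; have := card_weil_diff; have := card_weil_add; lia.
by have := weil_signs_excl a; rewrite !in_setU; case: (_ \in _); case: (1 - a \in weil_pos).
Qed.

Lemma card_heavy : #|heavy| = (3 ^ (2 * h) - 3 ^ h)%N.
Proof.
rewrite card_shift => [|a]; first by rewrite q2E; have := card_weil_diff; have := card_weil_add; lia.
have := weil_signs_excl a; rewrite !in_setU.
by case: (1 + a \in weil_neg); case: (1 - a \in weil_neg); rewrite ?orbT.
Qed.

Lemma light0 : (0 \in light) = false.
Proof. by rewrite !inE subr0 addr0 weil1 eq_sym (negPf q2_neq0). Qed.

Lemma heavy0 : (0 \in heavy) = false.
Proof. by rewrite !inE subr0 addr0 weil1 eq_sym oppr_eq0 (negPf q2_neq0). Qed.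

(** Separates the three weights from one another and from 0. *)
Lemma pow_lt : (0 < 3 ^ (2 * h - 2) < 3 ^ (3 * h - 2))%N.
Proof. by rewrite expn_gt0 ltn_exp2l //; have := h_gt0; lia. Qed.

Lemma wt_gt0 (a : F) : a != 0 -> (0 < wt (cw a))%N.
Proof. by move=> a0; have := pow_lt; case: (wt_cases _ a0) => -[_ _]; lia. Qed.

(** * Dimension and weight distribution *)

Lemma codewordB x y : cw (x - y) = cw x - cw y.
Proof. by apply/ffunP => i; rewrite !ffunE mulrBl trD trN. Qed.

Lemma codeword_eq0 a : (cw a == 0) = (a == 0).
Proof.
apply/idP/idP => [|/eqP ->]; last by apply/eqP/ffunP => i; rewrite !ffunE mul0r tr0.
apply: contraTT => /(wt_gt0 _); apply: contraTneq => ->.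
by rewrite /wt (_ : [set _ | _] = set0) ?cards0 //; apply/setP => i; rewrite !inE ffunE eqxx.
Qed.

Lemma codeword_inj : injective (fun a => cw a).
Proof.
by move=> x y /= e; apply/eqP; rewrite -subr_eq0 -codeword_eq0 codewordB e subrr.
Qed.

Lemma card_codeD : #|codeD m D| = (3 ^ m)%N.
Proof. by rewrite card_imset ?cardT -?cardE //; exact: codeword_inj. Qed.

Lemma card_weight w :
  #|[set c in codeD m D | (c != 0) && (wt c == w)]|
    = #|[set a : F | (a != 0) && (wt (cw a) == w)]|.
Proof.
rewrite -(card_imset _ codeword_inj); apply: eq_card => c; rewrite !inE.
apply/andP/imsetP => [[/imsetP [a _ ->]]|[a + ->]].
  by rewrite codeword_eq0 => aw; exists a => //; rewrite inE.
by rewrite inE codeword_eq0 => aw; split => //; apply: imset_f.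
Qed.

Lemma weight_distribution w :
  #|[set c in codeD m D | (c != 0) && (wt c == w)]|
    = (if w == 3 ^ (3 * h - 2) - 3 ^ (2 * h - 2) then 3 ^ (2 * h) + 3 ^ h
       else if w == 3 ^ (3 * h - 2) then 3 ^ (3 * h) - 2 * 3 ^ (2 * h) - 1
       else if w == 3 ^ (3 * h - 2) + 3 ^ (2 * h - 2) then 3 ^ (2 * h) - 3 ^ h
       else 0)%N.
Proof.
rewrite card_weight; have pl := pow_lt.
(* The middle weight collects the nonzero [a] that are neither light nor heavy, so its multiplicity
   is obtained by complement. *)
have classify (a : F) : (a != 0) && (wt (cw a) == w) =
   (if w == 3 ^ (3 * h - 2) - 3 ^ (2 * h - 2) then a \in light
       else if w == 3 ^ (3 * h - 2) then a \in ~: (0%R |: (light :|: heavy))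
       else if w == 3 ^ (3 * h - 2) + 3 ^ (2 * h - 2) then a \in heavy
       else false)%N.
  rewrite in_setC in_setU1 in_setU.
  have [->|a0] := eqVneq a 0; first by rewrite light0 heavy0; do 3?case: ifP => // _.
  rewrite /=; case: (wt_cases _ a0) => -[-> ->].
  - by move=> e; rewrite (_ : wt (cw a) = 3 ^ (3 * h - 2) - 3 ^ (2 * h - 2))%N; last lia;
      rewrite eq_sym; case: eqP => // _; do 2?case: ifP => // _.
  - move=> ->; case: eqP => [<-|n1]; do 3?case: eqP => //=; lia.
  - move=> ->; case: eqP => [<-|n1]; do 3?case: eqP => //=; lia.
rewrite (eq_card (B := [pred a | if (w == 3 ^ (3 * h - 2) - 3 ^ (2 * h - 2))%N then a \in light
       else if (w == 3 ^ (3 * h - 2))%N then a \in ~: (0%R |: (light :|: heavy))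
       else if (w == 3 ^ (3 * h - 2) + 3 ^ (2 * h - 2))%N then a \in heavy
       else false])); last by move=> a; rewrite [LHS]inE classify.
case: ifP => _; first exact: card_light.
case: ifP => _; last first.
  by case: ifP => _; [exact: card_heavy | exact: eq_card0].
transitivity #|~: (0%R |: (light :|: heavy))|; first exact: eq_card.
rewrite cardsCs setCK hcard cardsU1 in_setU light0 heavy0 /= cardsU.
rewrite (_ : light :&: heavy = set0) ?cards0 ?card_light ?card_heavy; last first.
  apply/setP => a; rewrite in_setI in_set0.
  have [->|a0] := eqVneq a 0; first by rewrite light0.
  by case: (wt_cases _ a0) => -[-> -> _].
by rewrite q2E; have := q_gt1; nia.
Qed.

End Field.

Theorem mainTheorem11 (h : nat) (F : finFieldType) (alpha : F)
  (hodd : odd h)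
  (hcard : #|F| = (3 ^ (3 * h))%N)
  (hgen : (3 ^ (3 * h) - 1)%N.-primitive_root alpha) :
  let m := (3 * h)%N in
  let D := defSet h alpha in
  let C := codeD m D in
  let d := (3 ^ (3 * h - 2) - 3 ^ (2 * h - 2))%N in
  [/\ size D = ((3 ^ (3 * h - 1) - 1) %/ 2)%N,
      #|C| = (3 ^ (3 * h))%N,
      (exists2 c, c \in C & (c != 0) && (wt c == d)),
      (forall c, c \in C -> c != 0 -> (d <= wt c)%N) &
      forall w : nat,
        #|[set c in C | (c != 0) && (wt c == w)]| =
          (if w == d then 3 ^ (2 * h) + 3 ^ h
           else if w == 3 ^ (3 * h - 2) then 3 ^ (3 * h) - 2 * 3 ^ (2 * h) - 1
           else if w == 3 ^ (3 * h - 2) + 3 ^ (2 * h - 2) then 3 ^ (2 * h) - 3 ^ h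
           else 0)%N].
Proof.
move=> m D C d.
have dist := weight_distribution h F hodd hcard alpha hgen.
split; [exact: size_defSet | exact: card_codeD | | | exact: dist].
  (* The smallest weight is attained because its multiplicity is positive. *)
  have : (0 < #|[set c in C | (c != 0%R) && (wt c == d)]|)%N.
    by rewrite dist eqxx addn_gt0 expn_gt0.
  by case/card_gt0P => c; rewrite inE => /andP[cC cd]; exists c.
move=> _ /imsetP [a _ ->]; rewrite (codeword_eq0 h F hodd hcard alpha hgen) => a0.
rewrite /d /D /m; case: (wt_cases h F hodd hcard alpha hgen a a0) => -[_ _]; lia.
Qed.
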